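(* Let $n\in\mathbb{N}$ and $\lambda\in(0,\frac{2\pi}{n}]$. If $F\in\overline{\mathcal{D}}_{n}(\lambda)$ has one zero on $\mathbb{T}$, then $F\in\overline{\mathcal{T}}_{n}(\lambda)$ (and thus $F$ has all its zeros on $\mathbb{T}$).
   Context: All polynomials have complex coefficients. $\mathbb{D}$ is the open unit disk, $\overline{\mathbb{D}}$ its closure, $\mathbb{T}$ the unit circle. ''Has one zero on $\mathbb T$'' means that at least one zero lies on $\mathbb T$. For $\lambda\in(0,\frac{2\pi}{n})$, $\overline{\mathcal{T}}_{n}(\lambda)$ is the set of polynomials of degree $n$ all of whose zeros lie on $\mathbb{T}$ and such that each pair of zeros (counted with multiplicity) is separated by an angle of at least $\lambda$. Moreover $\overline{\mathcal{T}}_{n}(\frac{2\pi}{n})=\{a(1+bz^{n}):a\in\mathbb{C}\setminus\{0\},\,b\in\mathbb{T}\}$. For $\lambda\in(0,\frac{2\pi}{n})$ and a polynomial $F$ write $F_{+}(z)=F(e^{i\lambda/2}z)$, $F_{-}(z)=F(e^{-i\lambda/2}z)$. $\overline{\mathcal{D}}_{n}(\lambda)$ is the set of polynomials $F$ of degree $n$ with $$\operatorname{Im}\Bigl(e^{-in\lambda/2}\frac{F_{+}(z)}{F_{-}(z)}\Bigr)>0\quad\text{for all } z\in\mathbb{C}\setminus\overline{\mathbb{D}}.$$ For $\lambda=\frac{2\pi}{n}$: $\overline{\mathcal{D}}_{n}(\frac{2\pi}{n})=\{a(z^{n}-b):a\in\mathbb{C}\setminus\{0\},\,b\in\overline{\mathbb{D}}\}$.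 *)

(* Defs.v *)
From HB Require Import structures.
From mathcomp Require Export all_boot all_order all_algebra.
From mathcomp Require Export all_classical all_reals all_analysis.
From mathcomp Require Export complex.

Set Implicit Arguments.
Unset Strict Implicit.
Unset Printing Implicit Defensive.

Import Order.TTheory GRing.Theory Num.Theory.

Local Open Scope classical_set_scope.
Local Open Scope ring_scope.

(* e^{i theta} *)
Definition expi (R : realType) (theta : R) : R[i] :=
  Complex (cos theta) (sin theta).

(* The angle in [0, pi] between two points of the unit circle.  It is only
   used when there are at least two zeros, hence with separation bounds
   lambda < 2 pi / n <= pi. *)
Definition angle (R : realType) (z w : R[i]) : R :=
  acos (complex.Re (z * w^*)).

(* For lambda < 2 pi / n, s lists the zeros of F with multiplicity, so that a
   multiple zero counts as a pair of zeros at angle 0. *)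
Definition Tbar (R : realType) (n : nat) (lambda : R) : set {poly R[i]} :=
  if lambda == 2 * pi / n%:R then
    [set F : {poly R[i]} | exists a b : R[i],
       [/\ a != 0, `|b| = 1 & F = a *: (1 + b *: 'X^n)]]
  else
    [set F : {poly R[i]} | size F = n.+1 /\
       exists s : seq R[i],
         [/\ F = lead_coef F *: \prod_(w <- s) ('X - w%:P),
             forall w, w \in s -> `|w| = 1
           & pairwise (fun z w => lambda <= angle z w) s]].

(* Division by 0 yields 0, whose imaginary part is not positive: the condition
   for lambda < 2 pi / n therefore forces F (e^{- i lambda / 2} z) to be
   nonzero, i.e. the quotient to be defined, whenever |z| > 1. *)
Definition Dbar (R : realType) (n : nat) (lambda : R) : set {poly R[i]} :=
  if lambda == 2 * pi / n%:R then
    [set F : {poly R[i]} | exists a b : R[i],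
       [/\ a != 0, `|b| <= 1 & F = a *: ('X^n - b%:P)]]
  else
    [set F : {poly R[i]} | size F = n.+1 /\
       forall z : R[i], 1 < `|z| ->
         0 < complex.Im (expi (- (n%:R * lambda / 2)) *
               (F.[expi (lambda / 2) * z] / F.[expi (- (lambda / 2)) * z]))].

(* Main.v *)
Require Import Defs.
From mathcomp Require Import ring lra.

Set Implicit Arguments.
Unset Strict Implicit.
Unset Printing Implicit Defensive.

Import Order.TTheory GRing.Theory Num.Theory.
Import numFieldNormedType.Exports.
Local Open Scope classical_set_scope.
Local Open Scope ring_scope.

(** Write mu for lambda / 2 and w_1, ..., w_n for the zeros of F.  None of them
    lies outside the closed disk, since there the quotient in the definition
    of the class must be nonzero.  The extremal case lambda = 2 pi / n is
    read off from the explicit form a (z^n - b); assume lambda < 2 pi / n,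
    that is n mu < pi.

    At a point z outside the disk the quotient factors as
      e^(-i n mu) F(e^(i mu) z) / F(e^(-i mu) z)
        = prod_j (e^(i mu) - w_j / z) / (1 - e^(i mu) w_j / z),
    and for v in the open disk the factor (e^(i mu) - v) / (1 - e^(i mu) v) has
    a continuous argument [turn mu v] with value mu at v = 0.  That factor
    lies in the upper half plane, so each turn lies in ]0, pi[ ([turn_disk]).

    Let z come in from infinity along a ray.  The sum of the n turns starts at
    n mu < pi, varies continuously, and has a positive sine because the
    quotient has a positive imaginary part; hence it never reaches pi
    ([turn_sum_lt_pi]).  All turns being positive, any two of them add up to
    less than pi, hence to at most pi when z arrives at the unit circle
    ([turn_pair_le_pi]).

    But in the limit a zero on the circle at angular distance less than mu
    from z has turn exactly pi ([turn_circle]): it uses up the whole budget and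
    every other turn must vanish.  With z equal to a zero on the circle, no
    zero can be inside the disk, where the turn is still positive
    ([zeros_on_circle]).  With z the midpoint of two zeros at angle less than
    2 mu = lambda, the turns would add up to 2 pi ([zeros_separated]). *)

(** * Real and imaginary parts, and points of the unit circle *)

Section UnitCircle.
Variable R : realType.
Implicit Types (x y mu : R) (z w v : R[i]).

Lemma complex_ext z w : complex.Re z = complex.Re w ->
  complex.Im z = complex.Im w -> z = w.
Proof. by case: z w => [a b] [c d] /= -> ->. Qed.

Lemma ReM z w : complex.Re (z * w) =
  complex.Re z * complex.Re w - complex.Im z * complex.Im w.
Proof. by case: z w => [a b] [c d]. Qed.

Lemma ImM z w : complex.Im (z * w) =
  complex.Re z * complex.Im w + complex.Im z * complex.Re w.
Proof. by case: z w => [a b] [c d]. Qed.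

Lemma Re_conj z : complex.Re z^* = complex.Re z.
Proof. by case: z. Qed.

Lemma Im_conj z : complex.Im z^* = - complex.Im z.
Proof. by case: z. Qed.

Lemma expiD x y : expi (x + y) = expi x * expi y.
Proof.
by apply: complex_ext; rewrite ?ReM ?ImM /= ?cosD ?sinD //; ring.
Qed.

Lemma expi0 : expi 0 = 1 :> R[i].
Proof. by rewrite /expi cos0 sin0. Qed.

Lemma expi_neq0 x : expi x != 0.
Proof.
have : expi x * expi (- x) = 1 by rewrite -expiD subrr expi0.
by apply: contra_eq_neq => ->; rewrite mul0r eq_sym oner_neq0.
Qed.

Lemma expiN x : expi (- x) = (expi x)^-1.
Proof.
by apply: (mulIf (expi_neq0 x)); rewrite -expiD addNr expi0 mulVf ?expi_neq0.
Qed.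

Lemma norm_eq1_ReIm z :
  `|z| = 1 <-> complex.Re z ^+ 2 + complex.Im z ^+ 2 = 1.
Proof.
split=> [z1|e]; first by apply: complexI; rewrite add_Re2_Im2 z1 expr1n.
by rewrite normc_def e sqrtr1.
Qed.

Lemma norm_lt1_ReIm z :
  `|z| < 1 -> complex.Re z ^+ 2 + complex.Im z ^+ 2 < 1.
Proof. by move=> z1; rewrite -ltcR add_Re2_Im2 expr_lt1. Qed.

Lemma norm_expi x : `|expi x| = 1.
Proof. by apply/norm_eq1_ReIm; rewrite /= cos2Dsin2. Qed.

(** * The argument of a linear fractional factor *)

(** The principal argument on the right half plane. *)
Definition half_plane_arg z := atan (complex.Im z / complex.Re z).

Lemma half_plane_argP z : 0 < complex.Re z ->
  exists2 r : R, 0 < r & z = (r%:C)%C * expi (half_plane_arg z).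
Proof.
move=> Re_gt0; set a := half_plane_arg z.
have cos_gt0 : 0 < cos a.
  by apply: cos_gt0_pihalf; rewrite atan_gtNpi2 atan_ltpi2.
have tan_a : sin a / cos a = complex.Im z / complex.Re z by exact: atanK.
have sinE : sin a = complex.Im z / complex.Re z * cos a.
  by rewrite -tan_a divfK // gt_eqF.
exists (complex.Re z / cos a); first exact: divr_gt0.
apply: complex_ext; rewrite ?ReM ?ImM /= ?mul0r ?subr0 ?addr0.
  by rewrite divfK // gt_eqF.
by rewrite sinE; field; rewrite !gt_eqF.
Qed.

(** The argument of (e^(i mu) - v) / (1 - e^(i mu) v), in the continuous
    determination equal to mu at v = 0.  The numerator is written
    e^(i mu) (1 - e^(-i mu) v), so that only arguments of points of the right
    half plane are needed. *)
Definition turn mu v :=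
  mu + half_plane_arg (1 - expi (- mu) * v) - half_plane_arg (1 - expi mu * v).

(** The points v at which [turn mu v] is a genuine argument: for v in the closed
    disk this leaves out exactly e^(i mu) and e^(-i mu). *)
Definition regular mu v :=
  0 < complex.Re (1 - expi (- mu) * v) /\ 0 < complex.Re (1 - expi mu * v).

Lemma turn_bounds mu v : mu - pi < turn mu v < mu + pi.
Proof.
rewrite /turn /half_plane_arg; set p := _ / _; set q := _ / _.
have := atan_gtNpi2 p; have := atan_ltpi2 p.
by have := atan_gtNpi2 q; have := atan_ltpi2 q; move=> *; apply/andP; split; lra.
Qed.

Lemma turnP mu v : regular mu v -> exists2 r : R, 0 < r &
  expi mu * (1 - expi (- mu) * v) =
  (r%:C)%C * expi (turn mu v) * (1 - expi mu * v).
Proof.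
move=> [/half_plane_argP[r1 r1_gt0 E1] /half_plane_argP[r2 r2_gt0 E2]].
exists (r1 / r2); first exact: divr_gt0.
have r2_neq0 : (r2%:C)%C != 0 by rewrite fmorph_eq0 gt_eqF.
rewrite [in LHS]E1 [in RHS]E2 /turn !expiD [expi (- half_plane_arg _)]expiN.
rewrite rmorphM fmorphV /=.
have := expi_neq0 (half_plane_arg (1 - expi mu * v)).
set e2 := expi (half_plane_arg (1 - expi mu * v)).
set e1 := expi (half_plane_arg _); move: e1 e2 => e1 e2 e2_neq0.
by field; rewrite e2_neq0 r2_neq0.
Qed.

(** Multiplying (e^(i mu) - v) / (1 - e^(i mu) v) by the squared modulus of its
    denominator gives e^(i mu) + |v|^2 e^(-i mu) - 2 Re v, whose two parts are
    the left-hand sides below. *)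
Lemma turn_ReIm mu v : regular mu v -> exists2 r : R, 0 < r &
  (1 - (complex.Re v ^+ 2 + complex.Im v ^+ 2)) * sin mu = r * sin (turn mu v)
  /\ (1 + (complex.Re v ^+ 2 + complex.Im v ^+ 2)) * cos mu - 2 * complex.Re v
     = r * cos (turn mu v).
Proof.
move=> reg; have [r r_gt0 E] := turnP reg.
set D := 1 - expi mu * v in E.
have D_gt0 : 0 < complex.Re D by case: reg.
exists (r * (complex.Re D ^+ 2 + complex.Im D ^+ 2)).
  by rewrite mulr_gt0 // ltr_pwDl ?exprn_gt0 ?sqr_ge0.
have {}E : (expi mu - v) * D^* = (r%:C)%C * expi (turn mu v) * (D * D^*).
  by rewrite mulrA -E mulrBr mulr1 mulrA -expiD subrr expi0 mul1r.
have s2 := sin2cos2 mu.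
move: (congr1 (@complex.Re R) E) (congr1 (@complex.Im R) E).
rewrite !(ImM, ReM, Im_conj, Re_conj) /D /=.
case: v {E D D_gt0 reg} => a b /= ERe EIm.
by split; [refine (etrans _ (etrans EIm _)) | refine (etrans _ (etrans ERe _))];
  ring: s2.
Qed.

Lemma regular_disk mu v :
  complex.Re v ^+ 2 + complex.Im v ^+ 2 < 1 -> regular mu v.
Proof.
case: v => a b /= ab; have cs := cos2Dsin2 mu.
have := sqr_ge0 (cos mu - a); have := sqr_ge0 (sin mu - b).
by have := sqr_ge0 (sin mu + b); split; rewrite /= ?cosN ?sinN; nra.
Qed.

(** The sine is positive by [turn_ReIm]; [turn_bounds] confines the turn to
    ]-pi, 2 pi[, where this leaves only ]0, pi[. *)
Lemma turn_disk mu v : 0 < mu < pi ->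
  complex.Re v ^+ 2 + complex.Im v ^+ 2 < 1 -> 0 < turn mu v < pi.
Proof.
move=> /[dup] mu_pi /andP[mu_gt0 mu_lt] v1.
have [r r_gt0 [E _]] := turn_ReIm (regular_disk mu v1).
have sin_gt0 : 0 < sin (turn mu v).
  by rewrite -(pmulr_rgt0 _ r_gt0) -E mulr_gt0 ?subr_gt0 // sin_gt0_pi.
have /andP[lb ub] := turn_bounds mu v.
apply/andP; split; rewrite ltNge; apply/negP => le.
  have : 0 <= sin (- turn mu v) by apply: sin_ge0_pi; apply/andP; split; lra.
  by rewrite sinN; lra.
have : 0 <= sin (turn mu v - pi).
  by apply: sin_ge0_pi; apply/andP; split; lra.
by rewrite sinB cospi sinpi; lra.
Qed.

Lemma regular_circle mu v : complex.Re v ^+ 2 + complex.Im v ^+ 2 = 1 ->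
  cos mu < complex.Re v -> regular mu v.
Proof.
case: v => a b /= ab lt; have cs := cos2Dsin2 mu.
have : 0 < (a - cos mu) ^+ 2 by rewrite exprn_gt0 ?subr_gt0.
have := sqr_ge0 (sin mu - b).
by have := sqr_ge0 (sin mu + b); split; rewrite /= ?cosN ?sinN; nra.
Qed.

(** On the circle the sine vanishes, and close to 1 the cosine is negative, so
    in the range allowed by [turn_bounds] the turn can only be pi. *)
Lemma turn_circle mu v : 0 < mu < pi ->
  complex.Re v ^+ 2 + complex.Im v ^+ 2 = 1 ->
  cos mu < complex.Re v -> turn mu v = pi.
Proof.
move=> /andP[mu_gt0 mu_lt] v1 win.
have [r r_gt0 []] := turn_ReIm (regular_circle v1 win).
rewrite v1 subrr mul0r => /esym /eqP; rewrite mulf_eq0 gt_eqF //= => /eqP s0 E.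
have c_lt0 : cos (turn mu v) < 0.
  by rewrite -(pmulr_rlt0 _ r_gt0) -E; lra.
have /andP[lb ub] := turn_bounds mu v.
move: (turn mu v) s0 c_lt0 lb ub => x s0 c_lt0 lb ub.
have [x_lt|x_gt|//] := ltgtP x pi.
  have [x_gt0|x_le0] := ltP 0 x.
    have : 0 < sin x by apply: sin_gt0_pi; rewrite x_gt0.
    by rewrite s0 ltxx.
  have [x_lt0|x_ge0] := ltP x 0.
    have : 0 < sin (- x) by apply: sin_gt0_pi; apply/andP; split; lra.
    by rewrite sinN s0 oppr0 ltxx.
  have x0 : x = 0 by lra.
  by move: c_lt0; rewrite x0 cos0 ltr10.
have : 0 < sin (x - pi) by apply: sin_gt0_pi; apply/andP; split; lra.
by rewrite sinB cospi sinpi s0; lra.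
Qed.

(** * The total turn along a ray *)

Lemma continuous_turn mu v (t : R) : regular mu ((t%:C)%C * v) ->
  {for t, continuous (fun s : R => turn mu ((s%:C)%C * v))}.
Proof.
have key w : 0 < complex.Re (1 - w * ((t%:C)%C * v)) ->
    {for t, continuous (fun s : R => half_plane_arg (1 - w * ((s%:C)%C * v)))}.
  have E s : half_plane_arg (1 - w * ((s%:C)%C * v)) =
      atan ((- (s * complex.Im (w * v))) / (1 - s * complex.Re (w * v))).
    by congr (atan (_ / _)); case: w v => [a b] [c d] /=; ring.
  move=> gt0; rewrite /prop_for /continuous_at E; under eq_fun do rewrite E.
  have ne0 : 1 - t * complex.Re (w * v) != 0.
    rewrite gt_eqF //; move: gt0.
    by congr (0 < _); case: w v {E} => [a b] [c d] /=; ring.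
  apply: continuous_cvg; first exact: continuous_atan.
  apply: cvgM; first by apply: cvgN; apply: cvgM; [exact: cvg_id|exact: cvg_cst].
  apply: cvgV => //; apply: cvgB; first exact: cvg_cst.
  by apply: cvgM; [exact: cvg_id|exact: cvg_cst].
move=> [r1 r2]; apply: cvgB; last exact: key.
by apply: cvgD; [exact: cvg_cst|exact: key].
Qed.

(** A path that starts below pi has to cross pi in order to exceed it, and the
    sine vanishes there. *)
Lemma path_lt_pi (f : R -> R) :
  (forall t, 0 <= t < 1 -> {for t, continuous f}) -> f 0 < pi ->
  (forall t, 0 < t < 1 -> 0 < sin (f t)) -> forall t, 0 <= t < 1 -> f t < pi.
Proof.
move=> fc f0 fs t /andP[t0 t1]; rewrite ltNge; apply/negP => ft.
have [||c /itvP cI fc_pi] := @IVT R f 0 t pi t0.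
- apply: continuous_in_subspaceT => x; rewrite inE/= => /itvP xI.
  by apply: fc; rewrite xI (le_lt_trans _ t1) ?xI.
- by rewrite ge_min le_max (ltW f0) ft orbT.
have c_gt0 : 0 < c.
  by rewrite lt_neqAle cI andbT; apply/eqP => c0; move: f0; rewrite c0 fc_pi ltxx.
have := fs c; rewrite fc_pi sinpi ltxx c_gt0 (le_lt_trans _ t1) ?cI //.
by move=> /(_ isT).
Qed.

(** The argument of the quotient is the sum of the turns of the points w / z;
    each zero absorbs one factor e^(-i mu) of the normalization. *)
Lemma rotated_quotient mu (z : R[i]) (s : seq R[i]) : z != 0 ->
  (forall w, w \in s -> regular mu (w / z)) ->
  exists2 r : R, 0 < r &
    expi (- ((size s)%:R * mu)) *
      (\prod_(w <- s) (expi mu * z - w) / \prod_(w <- s) (expi (- mu) * z - w))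
    = (r%:C)%C * expi (\sum_(w <- s) turn mu (w / z)).
Proof.
move=> z0; elim: s => [|w s IHs] reg.
  by exists 1; rewrite // !big_nil mul0r oppr0 expi0 invr1 !mulr1.
have [|r r_gt0 E] := IHs; first by move=> x xs; apply: reg; rewrite inE xs orbT.
have reg_w : regular mu (w / z) by apply: reg; rewrite mem_head.
have [q q_gt0 Ew] := turnP reg_w.
exists (q * r); first exact: mulr_gt0.
rewrite !big_cons expiD rmorphM /= mulrACA -E.
have den0 : 1 - expi mu * (w / z) != 0.
  by case: reg_w => _; apply: contraTneq => ->; rewrite ltxx.
have -> : (q%:C)%C * expi (turn mu (w / z)) =
    expi (- mu) * ((expi mu * z - w) / (expi (- mu) * z - w)).
  apply: (mulIf den0); rewrite -Ew.
  have e0 := expi_neq0 mu; rewrite expiN; field.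
  rewrite z0 e0 /=; apply: contra_neq den0 => zw.
  by rewrite -[RHS](mul0r z^-1) -zw; field.
rewrite -[(size (w :: s))%:R]/((size s).+1%:R) -natr1 mulrDl mul1r opprD expiD.
rewrite invfM; ring.
Qed.

Lemma horner_prod_roots (s : seq R[i]) (a z : R[i]) :
  (a *: \prod_(w <- s) ('X - w%:P)).[z] = a * \prod_(w <- s) (z - w).
Proof.
by rewrite hornerZ horner_prod; under eq_bigr do rewrite hornerXsubC.
Qed.

Lemma turn0 mu : turn mu 0 = mu.
Proof. by rewrite /turn !mulr0 addrK. Qed.

Lemma regular_scaled mu t w u : `|w| <= 1 -> `|u| = 1 -> 0 <= t < 1 ->
  regular mu ((t%:C)%C * (w * u)) /\
  complex.Re ((t%:C)%C * (w * u)) ^+ 2 + complex.Im ((t%:C)%C * (w * u)) ^+ 2 < 1.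
Proof.
move=> w1 u1 /andP[t0 t1].
have lt1 : `|(t%:C)%C * (w * u)| < 1.
  rewrite !normrM u1 mulr1 ger0_norm ?ler0c //.
  by rewrite (le_lt_trans (ler_piMr _ w1)) ?ler0c // -(rmorph1 (real_complex R)) ltcR.
by split; [apply: regular_disk|]; exact: norm_lt1_ReIm.
Qed.

(** The condition that defines the class, for the monic polynomial with zeros
    s; the leading coefficient cancels in the quotient. *)
Definition half_plane_condition mu (s : seq R[i]) := forall z, 1 < `|z| ->
  0 < complex.Im (expi (- ((size s)%:R * mu)) *
    (\prod_(w <- s) (expi mu * z - w) / \prod_(w <- s) (expi (- mu) * z - w))).

(** The ray consists of the points z with 1 / z = t u, from infinity (t = 0) to
    the unit circle (t = 1).  The hypothesis says nothing at infinity itself,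
    where all turns equal mu. *)
Lemma turn_sum_lt_pi mu (s : seq R[i]) u : (size s)%:R * mu < pi ->
  {in s, forall w, `|w| <= 1} -> half_plane_condition mu s -> `|u| = 1 ->
  forall t, 0 <= t < 1 -> \sum_(w <- s) turn mu ((t%:C)%C * (w * u)) < pi.
Proof.
move=> smu s1 pos u1; apply: path_lt_pi.
- move=> t t01; rewrite /prop_for /continuous_at.
  rewrite !big_seq; under eq_fun do rewrite big_seq.
  apply: cvg_big; [exact: add_continuous|move=> w ws]; apply: continuous_turn.
  by have [] := regular_scaled mu (s1 w ws) u1 t01.
- under eq_bigr do rewrite mul0r turn0.
  by rewrite big_const_seq count_predT iter_addr_0 -mulr_natl.
- move=> t /andP[t0 t1].
  have u0 : u != 0 by rewrite -normr_eq0 u1 oner_neq0.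
  have tu0 : (t%:C)%C * u != 0 by rewrite mulf_neq0 // fmorph_eq0 gt_eqF.
  pose z := ((t%:C)%C * u)^-1.
  have zE w : (t%:C)%C * (w * u) = w / z by rewrite /z invrK; ring.
  have z_gt1 : 1 < `|z|.
    rewrite /z normfV normrM u1 mulr1 ger0_norm ?ler0c ?ltW //.
    by rewrite invf_gt1 ?ltcR // -(rmorph1 (real_complex R)) ltcR.
  have [||r r_gt0 E] := @rotated_quotient mu z s.
  + by rewrite invr_eq0.
  + move=> w ws; rewrite -zE.
    by have [|] := @regular_scaled mu t w u (s1 w ws) u1; rewrite ?(ltW t0).
  + have := pos z z_gt1; rewrite E ImM /= mul0r addr0 pmulr_rgt0 //.
    by congr (0 < sin _); apply: eq_bigr => w _; rewrite zE.
Qed.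

(** Dropping the other turns, which are positive, leaves a strict inequality
    for t < 1.  Only the two selected turns need to be continuous at t = 1, so
    the other zeros may have singular turns there. *)
Lemma turn_pair_le_pi mu (s : seq R[i]) u (i j : 'I_(size s)) :
  0 < mu < pi -> (size s)%:R * mu < pi ->
  {in s, forall w, `|w| <= 1} -> half_plane_condition mu s -> `|u| = 1 ->
  i != j -> regular mu (s`_i * u) -> regular mu (s`_j * u) ->
  turn mu (s`_i * u) + turn mu (s`_j * u) <= pi.
Proof.
move=> mu_pi smu s1 pos u1 ij reg_i reg_j.
pose f t := turn mu ((t%:C)%C * (s`_i * u)) + turn mu ((t%:C)%C * (s`_j * u)).
have f_lt t : 0 <= t < 1 -> f t < pi.
  move=> t01; have := turn_sum_lt_pi smu s1 pos u1 t01.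
  apply: le_lt_trans; rewrite (big_nth 0) big_mkord (bigD1 i) //=.
  rewrite (bigD1 j) 1?eq_sym //= /f addrA lerDl sumr_ge0 // => k _.
  have [_ inn] := regular_scaled mu (s1 _ (mem_nth 0 (ltn_ord k))) u1 t01.
  by have /andP[/ltW] := turn_disk mu_pi inn.
have -> : turn mu (s`_i * u) + turn mu (s`_j * u) = f 1.
  by rewrite /f rmorph1 !mul1r.
have fc : f x @[x --> 1^'-] --> f 1.
  apply: cvg_at_left_filter.
  by apply: cvgD; apply: continuous_turn; rewrite rmorph1 mul1r.
rewrite -(cvg_lim (@Rhausdorff R) fc); apply: limr_le; first exact: cvgP fc.
near=> t; apply/ltW/f_lt; apply/andP; split; near: t; last exact: nbhs_left_lt.
exact: nbhs_left_ge.
Unshelve. all: by end_near. Qed.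

(** * Consequences for the zeros *)

(** The conjugate of u is the midpoint of the short arc between z and w:
    z = w e^(i e) with e = d or e = - d, d being the angle, and the midpoint
    is w e^(i e / 2).  It also makes sense for antipodal points, where
    normalizing z + w would fail. *)
Lemma close_points_in_arc z w (lambda : R) : `|z| = 1 -> `|w| = 1 ->
  lambda / 2 < pi -> angle z w < lambda ->
  exists u, [/\ `|u| = 1, cos (lambda / 2) < complex.Re (z * u)
               & cos (lambda / 2) < complex.Re (w * u)].
Proof.
move=> z1 w1 lam_pi; rewrite /angle.
have ww : w * w^* = 1 by rewrite -normCK w1 expr1n.
have zw1 : `|z * w^*| = 1 by rewrite normrM norm_conjC z1 w1 mulr1.
move/norm_eq1_ReIm: (zw1); set x := complex.Re _; set y := complex.Im _ => xy.
have x1 : -1 <= x <= 1 by apply/andP; split; nra.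
set d := acos x => d_lt.
have d_ge0 : 0 <= d by exact: acos_ge0.
have cos_d : cos d = x by apply: acosK; rewrite in_itv.
have cos_lt : cos (lambda / 2) < cos (d / 2).
  by rewrite ltr_cos ?in_itv /=; [lra|apply/andP; split; lra|apply/andP; split; lra].
have [e e2 zwE] : exists2 e, e ^+ 2 = d ^+ 2 & z * w^* = expi e.
  have : y ^+ 2 == sin d ^+ 2 by rewrite sin2cos2 cos_d -xy; apply/eqP; ring.
  rewrite eqf_sqr => /orP[]/eqP y_d; [exists d|exists (- d); first by rewrite sqrrN];
    by rewrite // /expi ?cosN ?sinN; apply: complex_ext.
have cos_e : cos (e / 2) = cos (d / 2).
  by move/eqP: e2; rewrite eqf_sqr => /orP[]/eqP ->; rewrite // mulNr cosN.
exists (w^* * expi (- (e / 2))); split.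
- by rewrite normrM norm_conjC w1 norm_expi mulr1.
- by rewrite mulrA zwE -expiD (_ : e - e / 2 = e / 2) /= ?cos_e //; field.
- by rewrite mulrA ww mul1r /= cosN cos_e.
Qed.

(** Arriving at the zero z on the circle, its turn is pi, which leaves no room
    for the positive turn of a zero inside the disk. *)
Lemma zeros_on_circle mu (s : seq R[i]) z : 0 < mu < pi ->
  (size s)%:R * mu < pi -> {in s, forall w, `|w| <= 1} ->
  half_plane_condition mu s -> z \in s -> `|z| = 1 ->
  {in s, forall w, `|w| = 1}.
Proof.
move=> mu_pi smu s1 pos zs z1 w ws; apply/eqP; rewrite eq_le s1 //=.
rewrite real_leNgt ?normr_real //; apply/negP => w_lt1.
have zJ1 : `|z^*| = 1 by rewrite norm_conjC.
have zz : z * z^* = 1 by rewrite -normCK z1 expr1n.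
have zz_T : complex.Re (z * z^*) ^+ 2 + complex.Im (z * z^*) ^+ 2 = 1.
  by apply/norm_eq1_ReIm; rewrite zz normr1.
have zz_win : cos mu < complex.Re (z * z^*).
  rewrite zz /= -(@cos0 R); case/andP: mu_pi => mu_gt0 mu_lt.
  by rewrite ltr_cos ?in_itv //= ?lexx ?pi_ge0 ?ltW.
have wz_in : complex.Re (w * z^*) ^+ 2 + complex.Im (w * z^*) ^+ 2 < 1.
  by apply: norm_lt1_ReIm; rewrite normrM zJ1 mulr1.
have i_lt : (index z s < size s)%N by rewrite index_mem.
have j_lt : (index w s < size s)%N by rewrite index_mem.
have ij : Ordinal i_lt != Ordinal j_lt.
  rewrite -(inj_eq val_inj) /=; apply: contraTneq w_lt1 => /(congr1 (nth 0 s)).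
  by rewrite !nth_index // => <-; rewrite z1 ltxx.
have := turn_pair_le_pi mu_pi smu s1 pos zJ1 ij.
rewrite /= !nth_index // (turn_circle mu_pi zz_T zz_win).
move=> /(_ (regular_circle zz_T zz_win) (regular_disk mu wz_in)).
by have /andP[turn_w _] := turn_disk mu_pi wz_in; lra.
Qed.

(** Arriving at the midpoint of two zeros that are too close, both turns are
    pi.  A multiple zero is covered, since the argument concerns positions in
    the list of zeros. *)
Lemma zeros_separated (lambda : R) (s : seq R[i]) : 0 < lambda / 2 < pi ->
  (size s)%:R * (lambda / 2) < pi -> {in s, forall w, `|w| = 1} ->
  half_plane_condition (lambda / 2) s ->
  pairwise (fun z w => lambda <= angle z w) s.
Proof.
move=> mu_pi smu s1 pos; apply/(pairwiseP 0) => i j; rewrite !inE => i_lt j_lt ij.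
rewrite leNgt; apply/negP => close.
have T k : (k < size s)%N -> `|s`_k| = 1 by move=> k_lt; apply/s1/mem_nth.
have /andP[_ mu_lt] := mu_pi.
have [u [u1 win_i win_j]] := close_points_in_arc (T i i_lt) (T j j_lt) mu_lt close.
have T' k : (k < size s)%N ->
    complex.Re (s`_k * u) ^+ 2 + complex.Im (s`_k * u) ^+ 2 = 1.
  by move=> k_lt; apply/norm_eq1_ReIm; rewrite normrM u1 mulr1 T.
have ne : Ordinal i_lt != Ordinal j_lt.
  by rewrite -(inj_eq val_inj) /= ltn_eqF.
have s1' : {in s, forall w, `|w| <= 1} by move=> w /s1 ->.
have := turn_pair_le_pi mu_pi smu s1' pos u1 ne.
rewrite /= !turn_circle ?T' // => /(_ (regular_circle (T' _ i_lt) win_i)).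
by move=> /(_ (regular_circle (T' _ j_lt) win_j)); have := pi_gt0 R; lra.
Qed.

End UnitCircle.

Theorem theorem8 (R : realType) (n : nat) (lambda : R) (F : {poly R[i]})
    (n_gt0 : (0 < n)%N)
    (lambda_gt0 : 0 < lambda) (lambda_le : lambda <= 2 * pi / n%:R)
    (FD : Dbar n lambda F)
    (F_zero_on_T : exists z : R[i], `|z| = 1 /\ root F z) :
  Tbar n lambda F /\ (forall z : R[i], root F z -> `|z| = 1).
Proof.
case: F_zero_on_T => z0 [z0_T z0_root]; move: FD; rewrite /Dbar /Tbar.
case: eqVneq => [_ [a [b [a0 b1 FE]]]|lambda_ne [sizeF FD]].
  have rootE z : root F z = (z ^+ n == b).
    by rewrite FE rootZ // rootE !hornerE subr_eq0.
  have bT : `|b| = 1.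
    by move: z0_root; rewrite rootE => /eqP <-; rewrite normrX z0_T expr1n.
  have b0 : b != 0 by rewrite -normr_eq0 bT oner_neq0.
  split=> [|z].
    exists (- (a * b)), (- b^-1); split.
    - by rewrite oppr_eq0 mulf_neq0.
    - by rewrite normrN normfV bT invr1.
    - rewrite FE scalerBr scalerDr scalerA mulrNN mulfK // scaleNr.
      by rewrite -alg_polyC scalerA addrC.
  rewrite rootE => /eqP zb; apply/eqP.
  by rewrite -(@pexpr_eq1 _ _ n) // -normrX zb bT.
have n_gt0R : 0 < n%:R :> R by rewrite ltr0n.
have n_mu : n%:R * (lambda / 2) < pi.
  have : lambda < 2 * pi / n%:R by rewrite lt_neqAle lambda_ne.
  by rewrite ltr_pdivlMr //; lra.
have mu_pi : 0 < lambda / 2 < pi.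
  have n_ge1 : 1 <= n%:R :> R by rewrite ler1n.
  by apply/andP; split; [lra|nra].
have [s FE] := closed_field_poly_normal F.
have F0 : F != 0 by rewrite -size_poly_eq0 sizeF.
have lead0 : lead_coef F != 0 by rewrite lead_coef_eq0.
have size_s : size s = n.
  by move: sizeF; rewrite FE size_scale // size_prod_XsubC => -[].
have root_s z : root F z = (z \in s) by rewrite FE rootZ // root_prod_XsubC.
have s1 : {in s, forall w, `|w| <= 1}.
  move=> w ws; rewrite real_leNgt ?normr_real //; apply/negP => w_gt1.
  (* At this point the denominator of the quotient is F(w) = 0. *)
  have := FD (expi (lambda / 2) * w).
  rewrite normrM norm_expi mul1r => /(_ w_gt1).
  have -> : expi (- (lambda / 2)) * (expi (lambda / 2) * w) = w.
    by rewrite mulrA -expiD addNr expi0 mul1r.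
  move: ws; rewrite -root_s rootE => /eqP ->.
  by rewrite invr0 !mulr0 ltxx.
have pos : half_plane_condition (lambda / 2) s.
  move=> z z_gt1; have := FD z z_gt1.
  by rewrite FE !horner_prod_roots size_s -mulrA -mulf_div divff // mul1r.
have z0_s : z0 \in s by rewrite -root_s.
rewrite -size_s in n_mu.
have sT := zeros_on_circle mu_pi n_mu s1 pos z0_s z0_T.
split=> [|z]; last by rewrite root_s => /sT.
by split=> //; exists s; split=> //; exact: zeros_separated.
Qed.
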